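(* For every complex number $q$ with $|q|<1$, $$\sum_{n=0}^\infty \frac{q^{2n(n-1)}(-q^4;q^4)_n(q;q^2)_{2n}}{(q^4;q^4)_{2n}} = \frac{f(-q,-q^7)+f(-q^3,-q^5)}{\varphi(-q^4)} = \frac{(q,q^7;q^8)_\infty+(q^3,q^5;q^8)_\infty}{(q^4;q^8)_\infty^2}.$$
   Context: Notation: $(a;q)_n=\prod_{j=0}^{n-1}(1-aq^j)$ (so $(a;q)_0=1$), $(a;q)_\infty=\prod_{j=0}^\infty(1-aq^j)$, and $(a_1,\dots,a_r;q)_\infty=(a_1;q)_\infty\cdots(a_r;q)_\infty$; the base may be replaced by a power of $q$. Ramanujan's theta function is $f(a,b)=\sum_{n=-\infty}^\infty a^{n(n+1)/2}b^{n(n-1)/2}$ for $|ab|<1$ (with $0^0=1$), and $\varphi(q)=f(q,q)$; $\varphi(-q^4)$ is $\varphi$ evaluated at $-q^4$. *)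

(* Defs.v *)
From HB Require Import structures.
From mathcomp Require Import all_boot all_order all_algebra.
From mathcomp Require Import complex.
From mathcomp Require Import all_classical all_reals all_analysis.

Set Implicit Arguments.
Unset Strict Implicit.
Unset Printing Implicit Defensive.

Import Order.TTheory GRing.Theory Num.Theory.
Import numFieldNormedType.Exports.

Local Open Scope classical_set_scope.
Local Open Scope ring_scope.

(* (a; q)_n *)
Definition qpoch (K : numFieldType) (a q : K) (n : nat) : K :=
  \prod_(j < n) (1 - a * q ^+ j).

(* (a; q)_oo; the limit exists whenever `|q| < 1 *)
Definition qpoch_inf (K : numFieldType) (a q : K) : K :=
  limn (qpoch a q).

(* (a_1, ..., a_r; q)_oo *)
Definition qpochs_inf (K : numFieldType) (s : seq K) (q : K) : K :=
  \prod_(a <- s) qpoch_inf a q.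

(* Sum over all n : int of u n, as the sum of the two one-sided series
   (n >= 0 and n <= -1). *)
Definition bilateral_sum (K : numFieldType) (u : int -> K) : K :=
  limn (series (fun n : nat => u n%:Z)) +
  limn (series (fun n : nat => u (- n.+1%:Z))).

(* Ramanujan's f(a, b). Both exponents are nonnegative integers, and
   0 ^ 0 = 1, so that no inverse power of a or b ever occurs. *)
Definition ramanujan_f (K : numFieldType) (a b : K) : K :=
  bilateral_sum (fun n : int =>
    a ^ ((n * (n + 1)) %/ 2)%Z * b ^ ((n * (n - 1)) %/ 2)%Z).

Definition ramanujan_phi (K : numFieldType) (q : K) : K := ramanujan_f q q.

(* Main.v *)
Require Import Defs.
From HB Require Import structures.
From mathcomp Require Import all_boot all_order all_algebra.
From mathcomp Require Import complex.
From mathcomp Require Import all_classical all_reals all_analysis.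
From mathcomp Require Import ring lra zify.

Set Implicit Arguments.
Unset Strict Implicit.
Unset Printing Implicit Defensive.

Import Order.TTheory GRing.Theory Num.Theory.
Import numFieldNormedType.Exports.
Local Open Scope classical_set_scope.
Local Open Scope ring_scope.
Local Open Scope complex_scope.

(** Write (a)_n for the q-shifted factorial to base p.  With p = q^4 the n-th
    term of the series is
      p^(n(n-1)/2) (q)_n (q^3)_n / ((p)_n (p; p^2)_n),
    which is the case a = q^-3, b = q^-1 of the series F(a, b) with terms
      p^(n(n-1)/2) (ap)_n (bp)_n / ((p)_n (abp^2; p^2)_n).
    It is close to the series
      G(a, b) = sum_n p^(n(n+1)/2) (a)_n (b)_n / ((p)_n (abp; p^2)_n),
    whose sum is given by the q-analogue of Gauss's second theorem:
      G(a, b) = (ap, bp; p^2)_oo / (p, abp; p^2)_oo    ([gauss_sum]).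

    For the latter, the difference between G(a, b) and
    (1 - ap) / (1 - abp) G(ap^2, b) telescopes ([gauss_telescope]).  Iterating
    moves a to 0, and the symmetry of G moves b to 0 in the same way; this
    leaves the constant G(0, 0), whose value comes from the degenerate case
    G(1, 0) = 1.

    F is contiguous to G: comparing terms, F(a, b) = G(ap, b) + G(a, bp),
    because the partial sums of the two sides differ by p^N times the last
    term of F ([contig_partial_sum]).  So F is a sum of two infinite products,
    which are (q^5, q^3; q^8)_oo and (q, q^7; q^8)_oo in the case at hand, both
    divided by (q^4; q^8)_oo^2.  The parameters a and b are powers of 1/q, so
    q = 0, where only the terms n = 0 and n = 1 survive, is treated apart.

    The theta functions become products through the Jacobi triple product
    ([jacobi_triple_product]); the factor (q^8; q^8)_oo cancels between
    numerator and denominator.  The triple product is the limit of its finite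
    form with Gaussian binomial coefficients ([finite_triple_product]).

    All interchanges of limits and sums are instances of Tannery's theorem
    ([tannery]): every series here is dominated by a geometric one. *)

(** * The modulus as a real number *)

(** A name for the complex numbers whose only visible structure is that of a
    numFieldType: topology and limits are then inferred from the norm, as in
    the definitions of the theta functions and infinite products, while
    terms over [R[i]] and over [CC R] remain convertible. *)
Definition CC (R : realType) : numFieldType := R[i].

(** The norm of a numFieldType takes its values in the field itself; the
    real-valued modulus makes the order total, and gives access to the
    theory of real sequences. *)
Definition cabs (R : realType) (z : CC R) : R := complex.Re (`|z| : R[i]).

Section Modulus.
Variable R : realType.
Implicit Types z w : CC R.

Lemma cabsE z : `|z| = ((cabs z)%:C : CC R).
Proof. by rewrite /cabs RRe_real // normr_real. Qed.

Lemma cabs_ge0 z : 0 <= cabs z.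
Proof. by rewrite -ler0c -cabsE normr_ge0. Qed.

Lemma cabs0 : cabs (0 : CC R) = 0.
Proof. by rewrite /cabs normr0. Qed.

Lemma cabs1 : cabs (1 : CC R) = 1.
Proof. by rewrite /cabs normr1. Qed.

Lemma cabs_eq0 z : (cabs z == 0) = (z == 0).
Proof. by rewrite -(normr_eq0 z) cabsE; apply/eqP/eqP => [->|[->]]. Qed.

Lemma cabsM z w : cabs (z * w) = cabs z * cabs w.
Proof. by apply: complexI; rewrite rmorphM /= -!cabsE normrM. Qed.

Lemma cabsN z : cabs (- z) = cabs z.
Proof. by rewrite /cabs normrN. Qed.

Lemma cabsB z w : cabs (z - w) = cabs (w - z).
Proof. by rewrite -cabsN opprB. Qed.

Lemma cabsX z n : cabs (z ^+ n) = cabs z ^+ n.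
Proof. by apply: complexI; rewrite rmorphXn /= -!cabsE normrX. Qed.

Lemma cabsV z : cabs z^-1 = (cabs z)^-1.
Proof. by apply: complexI; rewrite fmorphV /= -!cabsE normfV. Qed.

Lemma cabsD z w : cabs (z + w) <= cabs z + cabs w.
Proof. by rewrite -lecR rmorphD /= -!cabsE ler_normD. Qed.

Lemma cabs_sum (F : nat -> CC R) n :
  cabs (\sum_(0 <= k < n) F k) <= \sum_(0 <= k < n) cabs (F k).
Proof.
elim: n => [|n IH]; first by rewrite !big_geq // cabs0.
by rewrite !big_nat_recr //= (le_trans (cabsD _ _)) // lerD2r.
Qed.

Lemma cabs_def z :
  cabs z = Num.sqrt (complex.Re (z : R[i]) ^+ 2 + complex.Im (z : R[i]) ^+ 2).
Proof. by rewrite /cabs normc_def. Qed.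

Lemma Re_le_cabs z : `|complex.Re (z : R[i])| <= cabs z.
Proof. by rewrite cabs_def -sqrtr_sqr ler_wsqrtr // lerDl sqr_ge0. Qed.

Lemma Im_le_cabs z : `|complex.Im (z : R[i])| <= cabs z.
Proof. by rewrite cabs_def -sqrtr_sqr ler_wsqrtr // lerDr sqr_ge0. Qed.

(** With [Re_le_cabs] and [Im_le_cabs], this reduces convergence of complex
    sequences to that of their real and imaginary parts, hence to the
    completeness of the reals. *)
Lemma cabs_le_ReIm z :
  cabs z <= `|complex.Re (z : R[i])| + `|complex.Im (z : R[i])|.
Proof.
rewrite cabs_def -[leRHS]ger0_norm ?addr_ge0 // -sqrtr_sqr ler_wsqrtr //.
rewrite sqrrD !real_normK ?num_real // -addrA lerD2l lerDr.
by rewrite mulrn_wge0 // mulr_ge0.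
Qed.

Lemma cabs_lt1 z : (`|z| < 1) = (cabs z < 1).
Proof. by rewrite cabsE -ltcR. Qed.

Lemma cvg_cabs (u : nat -> CC R) (l : CC R) :
  u @ \oo --> l <-> (fun n => cabs (u n - l)) @ \oo --> (0 : R).
Proof.
split=> [/cvgrPdistC_lt H|/cvgrPdistC_lt H]; apply/cvgrPdistC_lt => e e0.
  have : 0 < (e%:C : CC R) by rewrite ltcR.
  move/H; apply: filterS => n.
  by rewrite cabsE ltcR subr0 ger0_norm // cabs_ge0.
have [e' e'E] : exists e' : R, e = (e'%:C : CC R).
  by exists (complex.Re (e : R[i])); rewrite RRe_real // realE ltW.
move: e0; rewrite {}e'E ltcR => /H; apply: filterS => n.
by rewrite cabsE ltcR subr0 ger0_norm // cabs_ge0.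
Qed.

Lemma cvg_cabs_squeeze (u : nat -> CC R) (l : CC R) (e : nat -> R) :
  (forall n, cabs (u n - l) <= e n) -> e @ \oo --> (0 : R) -> u @ \oo --> l.
Proof.
move=> ule e0; apply/cvg_cabs; apply: squeeze_cvgr e0; last exact: cvg_cst.
by near=> n; rewrite cabs_ge0 ule.
Unshelve. all: by end_near. Qed.

Lemma limE (u : nat -> CC R) (l : CC R) : u @ \oo --> l -> limn u = l.
Proof. by move=> ul; apply: cvg_lim ul; apply: norm_hausdorff. Qed.

Lemma cabs_cvg_le (u : nat -> CC R) (l : CC R) (B : R) :
  (forall n, cabs (u n) <= B) -> u @ \oo --> l -> cabs l <= B.
Proof.
move=> uB /cvg_cabs ul.
apply: (ler_cvg_to (a := \oo) (f := fun=> cabs l)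
  (g := fun n => cabs (u n - l) + B)).
- exact: cvg_cst.
- by rewrite -[X in _ --> X]add0r; apply: cvgD => //; apply: cvg_cst.
near=> n; rewrite -[in leLHS](subrK (u n) l) (le_trans (cabsD _ _)) //.
by rewrite cabsB lerD.
Unshelve. all: by end_near. Qed.

End Modulus.

(** * Dominated convergence of complex series *)

Section DominatedSeries.
Variable R : realType.
Implicit Types (u v : nat -> CC R) (C r : R).

Lemma geometric_sum_le r n : 0 <= r < 1 -> \sum_(0 <= k < n) r ^+ k <= (1 - r)^-1.
Proof.
move=> /andP[r0 r1]; rewrite -[leRHS]mul1r ler_pdivlMr ?subr_gt0 //.
have -> : (\sum_(0 <= k < n) r ^+ k) * (1 - r) = 1 - r ^+ n.
  elim: n => [|n IH]; first by rewrite big_geq // expr0; ring.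
  by rewrite big_nat_recr //= mulrDl IH exprS; ring.
by rewrite lerBlDr lerDl exprn_ge0.
Qed.

Lemma Re_series u n :
  complex.Re (series u n : R[i]) = series (fun k => complex.Re (u k : R[i])) n.
Proof.
rewrite /series /=; elim: n => [|n IH]; first by rewrite !big_geq.
by rewrite !big_nat_recr //= -IH; case: (\sum_(0 <= i < n) _) (u n) => [a b] [].
Qed.

Lemma Im_series u n :
  complex.Im (series u n : R[i]) = series (fun k => complex.Im (u k : R[i])) n.
Proof.
rewrite /series /=; elim: n => [|n IH]; first by rewrite !big_geq.
by rewrite !big_nat_recr //= -IH; case: (\sum_(0 <= i < n) _) (u n) => [a b] [].
Qed.

Lemma cvg_series_dominatedR (x : nat -> R) C r : 0 <= r < 1 ->
  (forall n, `|x n| <= C * r ^+ n) -> cvgn (series x).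
Proof.
move=> /andP[r0 r1] xle; apply: normed_cvg.
apply: (@series_le_cvg _ _ (geometric C r)) => //=.
- by move=> n; rewrite (le_trans _ (xle n)).
- by apply: is_cvg_geometric_series; rewrite ger0_norm.
Qed.

(** Apply absolute convergence over the reals to the real and imaginary
    parts separately. *)
Lemma cvg_series_dominated u C r : 0 <= r < 1 ->
  (forall n, cabs (u n) <= C * r ^+ n) -> series u @ \oo --> limn (series u).
Proof.
move=> r01 ule.
have /cvg_ex[a ra] : cvgn (series (fun k => complex.Re (u k : R[i]))).
  by apply: cvg_series_dominatedR r01 _ => n; apply: le_trans (ule n); apply: Re_le_cabs.
have /cvg_ex[b ib] : cvgn (series (fun k => complex.Im (u k : R[i]))).
  by apply: cvg_series_dominatedR r01 _ => n; apply: le_trans (ule n); apply: Im_le_cabs.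
have H : series u @ \oo --> ((a +i* b : R[i]) : CC R).
  apply: (@cvg_cabs_squeeze _ _ _
    (fun n => `|series (fun k => complex.Re (u k : R[i])) n - a| +
              `|series (fun k => complex.Im (u k : R[i])) n - b|)) => [n|].
    apply: le_trans (cabs_le_ReIm _) _.
    by rewrite -Re_series -Im_series; case: (series u n).
  rewrite -[X in _ --> X]addr0; apply: cvgD.
    by apply/norm_cvg0P/subr_cvg0.
  by apply/norm_cvg0P/subr_cvg0.
by rewrite (limE H).
Qed.

(** Dominated convergence for series. The difference of the two sums is at
    most the sum of M differences of terms, plus a geometric tail in which N
    does not occur: first choose M to make the tail small, then N. *)
Lemma tannery (u : nat -> nat -> CC R) v C r : 0 <= r < 1 ->
  (forall N k, cabs (u N k) <= C * r ^+ k) ->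
  (forall k, u ^~ k @ \oo --> v k) ->
  (fun N => limn (series (u N))) @ \oo --> limn (series v).
Proof.
move=> r01 ule uv; have /andP[r0 r1] := r01.
have vle k : cabs (v k) <= C * r ^+ k by apply: cabs_cvg_le (uv k) => N.
pose e N k := cabs (u N k - v k).
have ele N k : e N k <= 2 * C * r ^+ k.
  rewrite /e (le_trans (cabsD _ _)) // cabsN.
  by have := ule N k; have := vle k; lra.
have C0 : 0 <= 2 * C by have := ele 0 0%N; rewrite expr0 mulr1; apply: le_trans; apply: cabs_ge0.
(* Tannery's estimate, with the head cut at M and N fixed. *)
have key M N : cabs (limn (series (u N)) - limn (series v)) <=
    \sum_(0 <= k < M) e N k + 2 * C / (1 - r) * r ^+ M.
  have dcvg : (fun L => series (u N) L - series v L) @ \oo -->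
      limn (series (u N)) - limn (series v).
    by apply: cvgB; apply: cvg_series_dominated r01 _ => k.
  apply: cabs_cvg_le dcvg => L.
  rewrite /series /= -sumrB (le_trans (cabs_sum _ _)) //.
  apply: (@le_trans _ _ (\sum_(0 <= k < M + L) e N k)).
    rewrite (@big_cat_nat _ _ _ L 0 (M + L)) ?leq_addl //= lerDl.
    by apply: sumr_ge0 => k _; apply: cabs_ge0.
  rewrite (@big_cat_nat _ _ _ M 0 (M + L)) ?leq_addr //= lerD2l.
  rewrite -{1}[M]add0n big_addn addKn.
  apply: (@le_trans _ _ (2 * C * r ^+ M * \sum_(0 <= k < L) r ^+ k)).
    rewrite mulr_sumr; apply: ler_sum => k _.
    by rewrite (le_trans (ele _ _)) // exprD mulrA mulrAC.
  rewrite [leRHS]mulrAC ler_wpM2l ?(mulr_ge0 C0) ?exprn_ge0 //.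
  exact: geometric_sum_le.
apply/cvg_cabs/cvgrPdist_lt => eps eps0.
have e2 : 0 < eps / 2 by lra.
have : (fun M => 2 * C / (1 - r) * r ^+ M) @ \oo --> (2 * C / (1 - r) * 0 : R).
  by apply: cvgM; [exact: cvg_cst|apply: cvg_expr; rewrite ger0_norm].
rewrite mulr0 => /cvgrPdist_lt /(_ _ e2) [M _ /(_ M (leqnn M))] /=.
rewrite sub0r normrN => tailM.
have : (fun N => \sum_(0 <= k < M) e N k) @ \oo --> (0 : R).
  elim: M {tailM} => [|M IH].
    rewrite (_ : (fun N => _) = fun=> 0); first exact: cvg_cst.
    by apply/funext => N; rewrite big_geq.
  rewrite (_ : (fun N => _) = fun N => \sum_(0 <= k < M) e N k + e N M).
    2: by apply/funext => N; rewrite big_nat_recr.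
  rewrite -[X in _ --> X]addr0; apply: cvgD => //.
  exact/cvg_cabs.
move=> /cvgrPdist_lt /(_ _ e2); apply: filterS => N.
rewrite !sub0r !normrN [X in _ -> X < _]ger0_norm ?cabs_ge0 // => headN.
have := key M N; have := ler_norm (2 * C / (1 - r) * r ^+ M).
by have := ler_norm (\sum_(0 <= k < M) e N k); lra.
Qed.

End DominatedSeries.

(** * Finite and infinite q-shifted factorials *)

Section QPochhammerAlgebra.
Variable K : numFieldType.
Implicit Types (a q : K).

Lemma qpochS a q n : qpoch a q n.+1 = qpoch a q n * (1 - a * q ^+ n).
Proof. by rewrite /qpoch big_ord_recr. Qed.

Lemma qpoch0 a q : qpoch a q 0 = 1.
Proof. by rewrite /qpoch big_ord0. Qed.

Lemma qpoch_recl a q n : qpoch a q n.+1 = (1 - a) * qpoch (a * q) q n.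
Proof.
rewrite /qpoch big_ord_recl expr0 mulr1; congr (_ * _).
by apply: eq_bigr => j _; rewrite /= /bump add1n exprS mulrA.
Qed.

Lemma qpoch_dissect a q n :
  qpoch a q (2 * n) = qpoch a (q ^+ 2) n * qpoch (a * q) (q ^+ 2) n.
Proof.
elim: n => [|n IH]; first by rewrite muln0 !qpoch0 mulr1.
rewrite mulnSr addn2 !qpochS IH -(exprM q 2 n) (exprS q (2 * n)); ring.
Qed.

Lemma qpoch_sqr a q n : qpoch (a ^+ 2) (q ^+ 2) n = qpoch a q n * qpoch (- a) q n.
Proof.
elim: n => [|n IH]; first by rewrite !qpoch0 mulr1.
rewrite !qpochS IH -(exprM q 2 n) mulnC exprM; ring.
Qed.

End QPochhammerAlgebra.

Section QPochhammer.
Variable R : realType.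
Implicit Types (a q x : CC R) (r s : R).

(** Each factor is at most exp(s r^j), and the exponents form a geometric
    series. The bound depends on s and r alone, which makes the dominations
    below uniform in the parameters. *)
Lemma prod1D_le_expR (x : nat -> CC R) s r n : 0 <= r < 1 ->
  (forall j, cabs (x j) <= s * r ^+ j) ->
  cabs (\prod_(j < n) (1 + x j)) <= expR (s / (1 - r)).
Proof.
move=> r01 xle; have s0 : 0 <= s.
  by have := xle 0%N; rewrite expr0 mulr1; apply: le_trans; apply: cabs_ge0.
apply: (@le_trans _ _ (expR (s * \sum_(0 <= k < n) r ^+ k))); last first.
  by rewrite ler_expR ler_wpM2l // geometric_sum_le.
elim: n => [|n IH]; first by rewrite big_ord0 big_geq // mulr0 expR0 cabs1.
rewrite big_ord_recr big_nat_recr //= [in leRHS]mulrDr expRD cabsM.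
apply: ler_pM => //; rewrite ?cabs_ge0 // (le_trans (cabsD _ _)) // cabs1.
by apply: le_trans (expR_ge1Dx _); rewrite lerD2l.
Qed.

(** The partial products P_n telescope: P_(n+1) - P_n = P_n x_n, and the P_n
    are bounded, so the convergence is that of a dominated series. *)
Lemma cvg_prod1D (x : nat -> CC R) s r : 0 <= r < 1 ->
  (forall j, cabs (x j) <= s * r ^+ j) ->
  exists l : CC R, (fun n => \prod_(j < n) (1 + x j)) @ \oo --> l.
Proof.
move=> r01 xle; pose P n := \prod_(j < n) (1 + x j).
exists (1 + limn (series (fun n => P n * x n))).
rewrite (_ : (fun n => _) = fun n => 1 + series (fun n => P n * x n) n).
  apply: cvgD; first exact: cvg_cst.
  apply: (@cvg_series_dominated _ _ (expR (s / (1 - r)) * s) r) => // n.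
  by rewrite cabsM -mulrA ler_pM ?cabs_ge0 // prod1D_le_expR.
apply/funext; elim=> [|n IH]; first by rewrite /series /= big_ord0 big_geq // addr0.
transitivity (P n * (1 + x n)); first by rewrite /P big_ord_recr.
rewrite (_ : series _ n.+1 = series (fun n => P n * x n) n + P n * x n).
  by rewrite mulrDr mulr1 addrA -IH.
by rewrite /series /= big_nat_recr.
Qed.

Lemma cabs_qpoch_le a q s r n : 0 <= r < 1 -> cabs q <= r -> cabs a <= s ->
  cabs (qpoch a q n) <= expR (s / (1 - r)).
Proof.
move=> r01 qr as_.
apply: (@prod1D_le_expR (fun j => - (a * q ^+ j))) => // j.
by rewrite cabsN cabsM cabsX ler_pM ?exprn_ge0 ?cabs_ge0 // lerXn2r ?nnegrE ?cabs_ge0 //; case/andP: r01.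
Qed.

Lemma cabs_factor_lt1 a q j : cabs a < 1 -> cabs q < 1 -> cabs (a * q ^+ j) < 1.
Proof.
move=> a1 q1; rewrite cabsM cabsX; apply: le_lt_trans a1.
by rewrite ler_piMr ?cabs_ge0 // exprn_ile1 ?cabs_ge0 // ltW.
Qed.

Lemma sub1_neq0 x : cabs x < 1 -> 1 - x != 0.
Proof. by move=> x1; apply/eqP => /subr0_eq E; move: x1; rewrite -E cabs1 ltxx. Qed.

Lemma qpoch_neq0 a q n : cabs a < 1 -> cabs q < 1 -> qpoch a q n != 0.
Proof.
move=> a1 q1; apply/prodf_neq0 => j _.
by apply: sub1_neq0; apply: cabs_factor_lt1.
Qed.

(** The reciprocal of 1 - x is 1 + x / (1 - x), so the reciprocals of
    q-shifted factorials are products of the same kind as the factorials,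
    and the bounds and limits proved for products apply to both. *)
Lemma qpochV_prod a q s r : 0 <= r < 1 -> s < 1 -> cabs q <= r -> cabs a <= s ->
  exists2 y : nat -> CC R,
    (forall n, (qpoch a q n)^-1 = \prod_(j < n) (1 + y j)) &
    (forall j, cabs (y j) <= s / (1 - s) * r ^+ j).
Proof.
move=> /andP[r0 r1] s1 qr as_; have s0 : 0 <= s := le_trans (cabs_ge0 a) as_.
have nz j : 1 - a * q ^+ j != 0.
  by apply: sub1_neq0; apply: cabs_factor_lt1; [apply: le_lt_trans as_ s1|apply: le_lt_trans qr r1].
have leq j : cabs (a * q ^+ j) <= s * r ^+ j.
  by rewrite cabsM cabsX ler_pM ?exprn_ge0 ?cabs_ge0 // lerXn2r ?nnegrE ?cabs_ge0.
exists (fun j => a * q ^+ j / (1 - a * q ^+ j)) => [n|j].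
  rewrite /qpoch -prodfV; apply: eq_bigr => j _.
  by have := nz j; move: (a * q ^+ j) => x x0; field.
rewrite cabsM cabsV mulrAC ler_pM ?invr_ge0 ?cabs_ge0 // lef_pV2 ?posrE; last 2 first.
- by rewrite lt_neqAle eq_sym cabs_eq0 nz cabs_ge0.
- by rewrite subr_gt0.
have : s * r ^+ j <= s by rewrite ler_piMr // exprn_ile1 // ltW.
have := cabsD (1 - a * q ^+ j) (a * q ^+ j); rewrite subrK cabs1.
have := leq j; lra.
Qed.

Lemma cabs_qpochV_le a q s r n : 0 <= r < 1 -> s < 1 -> cabs q <= r -> cabs a <= s ->
  cabs (qpoch a q n)^-1 <= expR (s / (1 - s) / (1 - r)).
Proof.
move=> r01 s1 qr as_; have [y -> yle] := qpochV_prod r01 s1 qr as_.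
exact: prod1D_le_expR.
Qed.

Lemma cvg_qpoch a q : cabs q < 1 -> qpoch a q @ \oo --> qpoch_inf a q.
Proof.
move=> q1; have [||l pl] := @cvg_prod1D (fun j => - (a * q ^+ j)) (cabs a) (cabs q).
- by rewrite cabs_ge0.
- by move=> j; rewrite cabsN cabsM cabsX.
by rewrite /qpoch_inf (limE pl).
Qed.

(** The partial products and their reciprocals both converge, and the
    product of the two limits is 1. *)
Lemma qpoch_inf_neq0 a q : cabs a < 1 -> cabs q < 1 -> qpoch_inf a q != 0.
Proof.
move=> a1 q1; have q01 : 0 <= cabs q < 1 by rewrite cabs_ge0.
have [y yE yle] := qpochV_prod q01 a1 (lexx _) (lexx _).
have [l yl] := cvg_prod1D q01 yle.
have : (fun n => qpoch a q n * \prod_(j < n) (1 + y j)) @ \oo --> qpoch_inf a q * l.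
  exact: (cvgM (cvg_qpoch q1) yl).
rewrite (_ : (fun n => _) = fun=> 1); last first.
  by apply/funext => n; rewrite -yE divff // qpoch_neq0.
move/limE; rewrite (limE (cvg_cst _)) => E.
by apply/eqP => Z; move: E; rewrite Z mul0r => /eqP; rewrite oner_eq0.
Qed.

Lemma cvg_qpoch_arg (a : nat -> CC R) (b q : CC R) n : a @ \oo --> b ->
  (fun N => qpoch (a N) q n) @ \oo --> qpoch b q n.
Proof.
move=> ab; elim: n => [|n IH].
  rewrite (_ : (fun N => _) = fun=> 1); last by apply/funext => N; rewrite qpoch0.
  by rewrite qpoch0; apply: cvg_cst.
rewrite (_ : (fun N => _) = fun N => qpoch (a N) q n * (1 - a N * q ^+ n)).
  rewrite qpochS.
  exact: (cvgM IH (cvgB (cvg_cst _) (cvgM ab (cvg_cst _)))).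
by apply/funext => N; rewrite qpochS.
Qed.

Lemma cvg_exprC (x : CC R) : cabs x < 1 -> (fun n => x ^+ n) @ \oo --> (0 : CC R).
Proof.
move=> x1; apply: (@cvg_cabs_squeeze _ _ _ (fun n => cabs x ^+ n)) => [n|].
  by rewrite subr0 cabsX.
by apply: cvg_expr; rewrite ger0_norm // cabs_ge0.
Qed.

End QPochhammer.

(** * Gaussian binomials and the finite triple product *)

Section GaussianBinomials.
Variable K : numFieldType.
Implicit Types (a b q : K).

(** Defined by Pascal's rule, so that no division occurs and the finite
    identities below need no condition on q. *)
Fixpoint gauss_binom q n k : K :=
  match n, k with
  | _, 0 => 1
  | 0, _.+1 => 0
  | n'.+1, k'.+1 => gauss_binom q n' k' + q ^+ k'.+1 * gauss_binom q n' k'.+1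
  end.

Lemma gauss_binom0 q n : gauss_binom q n 0 = 1.
Proof. by case: n. Qed.

Lemma gauss_binom_small q n k : (n < k)%N -> gauss_binom q n k = 0.
Proof.
elim: n k => [|n IH] [|k] //= nk.
by rewrite !IH ?mulr0 ?addr0 // ltnW.
Qed.

Lemma gauss_binom_qpoch q n k : (k <= n)%N ->
  gauss_binom q n k * (qpoch q q k * qpoch q q (n - k)) = qpoch q q n.
Proof.
elim: n k => [|n IH] [|k] //= kn; try by rewrite /qpoch !big_ord0 ?subn0; ring.
have fac m : qpoch q q m.+1 = qpoch q q m * (1 - q ^+ m.+1).
  by rewrite qpochS -exprS.
rewrite subSS fac.
have IHk := IH k kn.
have [kn'|] := ltnP k n; last first.
  move=> nk; have -> : k = n by apply/eqP; rewrite eqn_leq nk andbT.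
  rewrite (@gauss_binom_small q n n.+1) // fac -{2}(IH n (leqnn n)); ring.
have := IH k.+1 kn'; rewrite fac => IHk1.
have E : (n - k = (n - k.+1).+1)%N by rewrite subnSK.
rewrite mulrDl.
have -> : gauss_binom q n k * (qpoch q q k * (1 - q ^+ k.+1) * qpoch q q (n - k))
   = qpoch q q n * (1 - q ^+ k.+1) by rewrite -IHk; ring.
have -> : q ^+ k.+1 * gauss_binom q n k.+1 *
     (qpoch q q k * (1 - q ^+ k.+1) * qpoch q q (n - k))
   = qpoch q q n * (q ^+ k.+1 * (1 - q ^+ (n - k))).
  by rewrite -IHk1 E fac; ring.
rewrite fac.
have -> : n.+1 = (k.+1 + (n - k))%N by rewrite addSn subnKC // ltnW.
rewrite exprD; ring.
Qed.

(** Pascal's rule in the form in which both inductions below consume it: one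
    more factor of a product splits the expansion in two. *)
Lemma gauss_binom_pascal_sum q n (F : nat -> K) :
  \sum_(0 <= i < n.+2) gauss_binom q n.+1 i * F i =
  \sum_(0 <= i < n.+1) gauss_binom q n i * F i.+1 +
  \sum_(0 <= i < n.+1) q ^+ i * (gauss_binom q n i * F i).
Proof.
rewrite big_nat_recl // [in X in _ = _ + X]big_nat_recl //= gauss_binom0 expr0 !mul1r.
under eq_bigr do rewrite mulrDl.
rewrite big_split /= addrCA; congr (_ + (_ + _)).
rewrite big_nat_recr //= gauss_binom_small // mulr0 mul0r addr0.
by apply: eq_bigr => i _; rewrite mulrA.
Qed.

(** Extracting the first factor replaces a by aq; Pascal's rule matches the
    two halves of (1 + a) times the expansion. *)
Lemma q_binomial a q n :
  qpoch (- a) q n = \sum_(0 <= i < n.+1) gauss_binom q n i * (a ^+ i * q ^+ 'C(i, 2)).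
Proof.
elim: n a => [|n IH] a.
  by rewrite /qpoch big_ord0 big_nat1 /= !expr0; ring.
have -> : qpoch (- a) q n.+1 = (1 + a) * qpoch (- (a * q)) q n.
  by rewrite qpoch_recl opprK mulNr.
rewrite gauss_binom_pascal_sum IH mulrDl mul1r addrC mulr_sumr.
congr (_ + _); apply: eq_bigr => i _.
  by rewrite binS bin1 exprS exprD exprMn; ring.
by rewrite exprMn; ring.
Qed.

(** The k-th term of f(a, b), with exponents k(k+1)/2 and k(k-1)/2 written
    as binomial coefficients: for k = -(n+1) these are C(n+1, 2) and C(n+2,
    2). *)
Definition theta_term a b (k : int) : K :=
  match k with
  | Posz n => a ^+ 'C(n.+1, 2) * b ^+ 'C(n, 2)
  | Negz n => a ^+ 'C(n.+1, 2) * b ^+ 'C(n.+2, 2)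
  end.

Arguments theta_term : simpl never.

Lemma theta_termN a b n : theta_term a b (- n%:Z) = a ^+ 'C(n, 2) * b ^+ 'C(n.+1, 2).
Proof. by case: n => [|n] //; rewrite -NegzE. Qed.

(** The quotient of the terms of index k and k - 1 is a^k b^(k-1). Stated
    with k = i - n and multiplied by (ab)^i, the relation involves no
    negative power, for either sign of k. *)
Lemma theta_term_shift a b n i :
  (a * b) ^+ i * theta_term a b (i%:Z - n%:Z - 1) =
  (a * b) ^+ n * b * theta_term a b (i%:Z - n%:Z).
Proof.
have [ni|in_] := ltnP n i.
  have [m ->] : exists m, i = (n + m).+1 by exists (i - n.+1)%N; lia.
  have -> : (n + m).+1%:Z - n%:Z - 1 = m%:Z by lia.
  have -> : (n + m).+1%:Z - n%:Z = m.+1%:Z by lia.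
  rewrite /theta_term (binS m.+1) (binS m) !bin1 !(exprD, exprS) !exprMn; ring.
have [m ->] : exists m, n = (i + m)%N by exists (n - i)%N; lia.
have -> : i%:Z - (i + m)%:Z - 1 = - (m.+1)%:Z by lia.
have -> : i%:Z - (i + m)%:Z = - m%:Z by lia.
rewrite !theta_termN (binS m.+1) (binS m) !bin1 !(exprD, exprS) !exprMn; ring.
Qed.

(** Induction on n from the q-binomial theorem: the new factor 1 + b (ab)^n
    is absorbed by one use of Pascal's rule, thanks to [theta_term_shift].
    Treating the two products asymmetrically makes a single step per factor
    suffice. *)
Lemma finite_triple_product a b m n :
  qpoch (- a) (a * b) m * qpoch (- b) (a * b) n =
  \sum_(0 <= i < (m + n).+1)
    gauss_binom (a * b) (m + n) i * theta_term a b (i%:Z - n%:Z).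
Proof.
elim: n => [|n IH].
  rewrite /(qpoch (- b)) big_ord0 mulr1 addn0 q_binomial; apply: eq_bigr => i _.
  by rewrite subr0 /theta_term binS bin1 exprD exprMn; ring.
rewrite addnS gauss_binom_pascal_sum.
have -> : qpoch (- b) (a * b) n.+1 = qpoch (- b) (a * b) n * (1 + b * (a * b) ^+ n).
  by rewrite qpochS mulNr opprK.
rewrite mulrA IH mulrDr mulr1 mulr_suml; congr (_ + _); apply: eq_bigr => i _.
  by congr (_ * theta_term _ _ _); lia.
have -> : i%:Z - n.+1%:Z = i%:Z - n%:Z - 1 by lia.
have := theta_term_shift a b n i; set x := theta_term _ _ _; set y := theta_term _ _ _.
by move=> E; rewrite [RHS]mulrCA E; ring.
Qed.

Lemma central_triple_product a b N :
  qpoch (- a) (a * b) N * qpoch (- b) (a * b) N =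
  \sum_(0 <= k < N.+1) gauss_binom (a * b) (N + N) (N + k) * theta_term a b k%:Z +
  \sum_(0 <= k < N) gauss_binom (a * b) (N + N) (N - k.+1) * theta_term a b (- k.+1%:Z).
Proof.
rewrite finite_triple_product (@big_cat_nat _ _ _ N) //=; last by lia.
rewrite addrC; congr (_ + _).
  rewrite -{1}[N]add0n big_addn (_ : ((N + N).+1 - N = N.+1)%N); last by lia.
  by apply: eq_bigr => k _; rewrite [(k + N)%N]addnC; congr (_ * theta_term _ _ _); lia.
rewrite big_nat_rev /=; apply: eq_big_nat => k /andP[_ kN].
by rewrite add0n; congr (_ * theta_term _ _ _); lia.
Qed.

End GaussianBinomials.

(** * The Jacobi triple product *)

Section TripleProduct.
Variable R : realType.
Implicit Types (a b q : CC R).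

Lemma theta_termE a b (k : int) :
  a ^ ((k * (k + 1)) %/ 2)%Z * b ^ ((k * (k - 1)) %/ 2)%Z = theta_term a b k.
Proof.
have tri m : ((m.+1%:Z * m%:Z) %/ 2)%Z = 'C(m.+1, 2)%:Z.
  by rewrite -PoszM divz_nat divn2 bin2.
case: k => [[|n]|n]; rewrite /theta_term.
- by rewrite !mul0r div0z !expr0z !bin_small // expr0 mulr1.
- have -> : n.+1%:Z * (n.+1%:Z + 1) = n.+2%:Z * n.+1%:Z by lia.
  have -> : n.+1%:Z * (n.+1%:Z - 1) = n.+1%:Z * n%:Z by lia.
  by rewrite !tri.
have -> : Negz n * (Negz n + 1) = n.+1%:Z * n%:Z by rewrite NegzE; lia.
have -> : Negz n * (Negz n - 1) = n.+2%:Z * n.+1%:Z by rewrite NegzE; lia.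
by rewrite !tri.
Qed.

Lemma leq_bin2 n : (n <= 'C(n.+1, 2))%N.
Proof. by rewrite binS bin1 leq_addl. Qed.

Lemma cabs_theta_term_pos a b n : cabs a < 1 -> cabs b < 1 ->
  cabs (theta_term a b n%:Z) <= cabs a ^+ n.
Proof.
move=> a1 b1; rewrite /theta_term cabsM !cabsX -[leRHS]mulr1.
rewrite ler_pM ?exprn_ge0 ?cabs_ge0 //; last by rewrite exprn_ile1 ?cabs_ge0 // ltW.
by rewrite ler_wiXn2l ?cabs_ge0 ?leq_bin2 // ltW.
Qed.

Lemma cabs_theta_term_neg a b n : cabs a < 1 -> cabs b < 1 ->
  cabs (theta_term a b (- n.+1%:Z)) <= cabs b ^+ n.
Proof.
move=> a1 b1; rewrite theta_termN cabsM !cabsX -[leRHS]mul1r.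
rewrite ler_pM ?exprn_ge0 ?cabs_ge0 //; first by rewrite exprn_ile1 ?cabs_ge0 // ltW.
rewrite ler_wiXn2l ?cabs_ge0 //; first exact: ltW.
by rewrite (leq_trans (leqnSn n)) // leq_bin2.
Qed.

Lemma cabsM_lt1 a b : cabs a < 1 -> cabs b < 1 -> cabs (a * b) < 1.
Proof.
by move=> a1 b1; rewrite -(expr1 b); apply: cabs_factor_lt1.
Qed.

(** A quotient of q-shifted factorials, each bounded above and away from
    zero. *)
Lemma gauss_binom_bounded q : cabs q < 1 ->
  exists B, forall n k, cabs (gauss_binom q n k) <= B.
Proof.
move=> q1; have q01 : 0 <= cabs q < 1 by rewrite cabs_ge0.
pose E := expR (cabs q / (1 - cabs q)).
pose E' := expR (cabs q / (1 - cabs q) / (1 - cabs q)).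
exists (E * (E' * E')) => n k; have [kn|nk] := leqP k n; last first.
  by rewrite gauss_binom_small // cabs0 !mulr_ge0 ?expR_ge0.
have nz m := qpoch_neq0 m q1 q1.
have -> : gauss_binom q n k = qpoch q q n * ((qpoch q q k)^-1 * (qpoch q q (n - k))^-1).
  by rewrite -(gauss_binom_qpoch q kn); field; rewrite !nz.
rewrite !cabsM !ler_pM ?mulr_ge0 ?cabs_ge0 //.
- exact: cabs_qpoch_le.
- exact: cabs_qpochV_le.
- exact: cabs_qpochV_le.
Qed.

Lemma cvg_near_eq (u v : nat -> CC R) (l : CC R) : u @ \oo --> l ->
  (\forall n \near \oo, u n = v n) -> v @ \oo --> l.
Proof. by move=> ul uv; apply: cvg_trans (near_eq_cvg uv) ul. Qed.

Lemma cvg_gauss_binom q (n k : nat -> nat) : cabs q < 1 ->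
  k @ \oo --> \oo -> (fun N => n N - k N)%N @ \oo --> \oo ->
  (\forall N \near \oo, (k N <= n N)%N) ->
  (fun N => gauss_binom q (n N) (k N)) @ \oo --> (qpoch_inf q q)^-1.
Proof.
move=> q1 koo nkoo kn.
have noo : n @ \oo --> \oo.
  apply/cvgnyPge => A; move/cvgnyPge/(_ A): nkoo; apply: filterS => N An.
  exact: leq_trans An (leq_subr _ _).
have q0 : qpoch_inf q q != 0 by apply: qpoch_inf_neq0.
have ck := cvg_comp _ _ koo (@cvg_qpoch _ q q q1).
have cnk := cvg_comp _ _ nkoo (@cvg_qpoch _ q q q1).
have cn := cvg_comp _ _ noo (@cvg_qpoch _ q q q1).
have qq0 : qpoch_inf q q * qpoch_inf q q != 0 by rewrite mulf_neq0.
have lim : (fun N => qpoch q q (n N) * (qpoch q q (k N) * qpoch q q (n N - k N))^-1)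
    @ \oo --> qpoch_inf q q * (qpoch_inf q q * qpoch_inf q q)^-1.
  exact: (cvgM cn (cvgV qq0 (cvgM ck cnk))).
have <- : qpoch_inf q q * (qpoch_inf q q * qpoch_inf q q)^-1 = (qpoch_inf q q)^-1.
  by field.
apply: cvg_near_eq lim _; apply: filterS kn => N knN.
rewrite -(gauss_binom_qpoch q knN); field.
by rewrite !qpoch_neq0.
Qed.

Lemma limn_series_finite (u : nat -> CC R) N : (forall k, (N <= k)%N -> u k = 0) ->
  limn (series u) = \sum_(0 <= k < N) u k.
Proof.
move=> u0; apply: limE; rewrite -(cvg_shiftn N).
rewrite (_ : (fun n => _) = fun=> \sum_(0 <= k < N) u k); first exact: cvg_cst.
apply/funext => n; rewrite /series /= (@big_cat_nat _ _ _ N) ?leq_addl //=.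
have -> : \sum_(N <= k < n + N) u k = 0; last by rewrite addr0.
by rewrite big_nat_cond big1 // => k /andP[/andP[/u0]].
Qed.

(** Let N tend to infinity in [central_triple_product]. Each Gaussian
    binomial tends to 1 / (ab; ab)_oo, and its boundedness together with the
    geometric decay of the theta terms gives the domination. *)
Theorem jacobi_triple_product a b : cabs a < 1 -> cabs b < 1 ->
  ramanujan_f a b =
  qpoch_inf (- a) (a * b) * qpoch_inf (- b) (a * b) * qpoch_inf (a * b) (a * b).
Proof.
move=> a1 b1; have q1 := cabsM_lt1 a1 b1.
have [B Ble] := gauss_binom_bounded q1.
have B0 : 0 <= B := le_trans (cabs_ge0 _) (Ble 0%N 0%N).
have a01 : 0 <= cabs a < 1 by rewrite cabs_ge0.
have b01 : 0 <= cabs b < 1 by rewrite cabs_ge0.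
have Q0 := qpoch_inf_neq0 q1 q1.
set Q := qpoch_inf (a * b) (a * b) in Q0 *.
(* The halves k >= 0 and k < 0 of the finite triple product, extended by
   zero to all k so that Tannery's theorem applies. In u the binomial
   vanishes by itself for k > N; in w truncated subtraction has to be
   guarded. *)
pose u N k := gauss_binom (a * b) (N + N) (N + k) * theta_term a b k%:Z.
pose w N k := (if (k < N)%N then gauss_binom (a * b) (N + N) (N - k.+1) else 0)
  * theta_term a b (- k.+1%:Z).
have cu : (fun N => limn (series (u N))) @ \oo -->
    limn (series (fun k => Q^-1 * theta_term a b k%:Z)).
  apply: (@tannery _ _ _ B (cabs a) a01) => [N k|k].
    rewrite /u cabsM; apply: ler_pM; [exact: cabs_ge0|exact: cabs_ge0|exact: Ble|].
    exact: cabs_theta_term_pos.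
  apply: cvgM; last exact: cvg_cst.
  apply: cvg_gauss_binom => //; first exact: cvg_addnr.
    rewrite (_ : (fun N => _) = (fun N => N - k)%N); first exact: cvg_subnr.
    by apply/funext => N; rewrite subnDl.
  by near=> N; rewrite leq_add2l; near: N; apply: nbhs_infty_ge.
have cw : (fun N => limn (series (w N))) @ \oo -->
    limn (series (fun k => Q^-1 * theta_term a b (- k.+1%:Z))).
  apply: (@tannery _ _ _ B (cabs b) b01) => [N k|k].
    rewrite /w cabsM; apply: ler_pM; [exact: cabs_ge0|exact: cabs_ge0| |].
      by case: ifP => _; [exact: Ble|rewrite cabs0].
    exact: cabs_theta_term_neg.
  apply: cvgM; last exact: cvg_cst.
  have := @cvg_gauss_binom (a * b) (fun N => N + N)%N (fun N => N - k.+1)%N q1.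
  move=> /(_ (@cvg_subnr _)) H; apply: cvg_near_eq (H _ _) _; last first.
  - by near=> N; rewrite ifT //; near: N; apply: nbhs_infty_gt.
  - by near=> N; lia.
  - apply/cvgnyPge => A; near=> N.
    by have : (A <= N)%N; [near: N; apply: nbhs_infty_ge|lia].
have cP : (fun N => limn (series (u N)) + limn (series (w N))) @ \oo -->
    qpoch_inf (- a) (a * b) * qpoch_inf (- b) (a * b).
  rewrite (_ : (fun N => _) =
      (fun N => qpoch (- a) (a * b) N * qpoch (- b) (a * b) N)).
    exact: (cvgM (cvg_qpoch q1) (cvg_qpoch q1)).
  apply/funext => N; rewrite central_triple_product; congr (_ + _).
    apply: limn_series_finite => k Nk.
    by rewrite /u gauss_binom_small ?mul0r //; lia.
  rewrite (@limn_series_finite _ N) => [|k Nk]; last by rewrite /w ltnNge Nk mul0r.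
  by apply: eq_big_nat => k /andP[_ kN]; rewrite /w kN.
have scale (v : nat -> CC R) r : 0 <= r < 1 -> (forall k, cabs (v k) <= r ^+ k) ->
    limn (series (fun k => Q^-1 * v k)) = Q^-1 * limn (series v).
  move=> r01 vr; apply: limE.
  rewrite (_ : series _ = fun n => Q^-1 * series v n).
    apply: cvgM; first exact: cvg_cst.
    by apply: (@cvg_series_dominated _ _ 1 r) => // k; rewrite mul1r.
  by apply/funext => n; rewrite /series /= mulr_sumr.
have := limE (cvgD cu cw); rewrite (limE cP).
rewrite (scale _ _ a01) => [|k]; last exact: cabs_theta_term_pos.
rewrite (scale _ _ b01) => [|k]; last exact: cabs_theta_term_neg.
have -> : ramanujan_f a b = limn (series (fun k => theta_term a b k%:Z)) +
    limn (series (fun k => theta_term a b (- k.+1%:Z))).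
  rewrite /ramanujan_f /bilateral_sum.
  by congr (limn (series _) + limn (series _)); apply/funext => k; rewrite theta_termE.
by rewrite -mulrDr => ->; rewrite mulrAC (mulVf Q0) mul1r.
Unshelve. all: by end_near. Qed.

End TripleProduct.

(** * The q-analogue of Gauss's second summation theorem *)

Section BasicSeries.
Variable R : realType.
Implicit Types (a b c p q x : CC R).

Lemma qpoch_inf0 q : qpoch_inf 0 q = 1.
Proof.
apply: limE; rewrite (_ : qpoch 0 q = fun=> 1); first exact: cvg_cst.
by apply/funext => n; rewrite /qpoch big1 // => j _; rewrite mul0r subr0.
Qed.

(** The part of a hypergeometric term that stays bounded in n, so that
    powers of p alone govern the convergence. *)
Definition hyp_ratio p a b c n : CC R :=
  qpoch a p n * qpoch b p n / (qpoch p p n * qpoch c (p ^+ 2) n).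

(** The summand of the q-analogue of Gauss's second theorem, the basic
    hypergeometric series with numerator parameters a, b and denominator
    parameters plus and minus the square root of abp, at argument -p. *)
Definition gauss_term p a b n : CC R :=
  p ^+ 'C(n.+1, 2) * hyp_ratio p a b (a * b * p) n.

(** The summand obtained from the one of [gauss_term], taken at (ap, bp),
    when p^n is removed and abp^3 is replaced by abp^2. *)
Definition contig_term p a b n : CC R :=
  p ^+ 'C(n, 2) * hyp_ratio p (a * p) (b * p) (a * b * p ^+ 2) n.

Lemma cabs_sqr_le p : cabs p < 1 -> cabs (p ^+ 2) <= cabs p.
Proof. by move=> p1; rewrite cabsX expr2 ler_piMr ?cabs_ge0 // ltW. Qed.

Lemma cabs_sqr_lt1 p : cabs p < 1 -> cabs (p ^+ 2) < 1.
Proof. by move=> p1; apply: le_lt_trans (cabs_sqr_le p1) p1. Qed.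

Lemma hyp_ratio_bounded p (A B s : R) : cabs p < 1 -> s < 1 ->
  exists M : R, forall a b c n, cabs a <= A -> cabs b <= B -> cabs c <= s ->
    cabs (hyp_ratio p a b c n) <= M.
Proof.
move=> p1 s1; have p01 : 0 <= cabs p < 1 by rewrite cabs_ge0.
pose r := cabs p.
exists (expR (A / (1 - r)) * expR (B / (1 - r)) *
  (expR (r / (1 - r) / (1 - r)) * expR (s / (1 - s) / (1 - r)))).
move=> a b c n aA bB cs; rewrite /hyp_ratio invfM 3!cabsM.
apply: ler_pM; rewrite ?mulr_ge0 ?cabs_ge0 //; apply: ler_pM; rewrite ?cabs_ge0 //.
- exact: cabs_qpoch_le.
- exact: cabs_qpoch_le.
- exact: cabs_qpochV_le.
- by apply: cabs_qpochV_le => //; apply: cabs_sqr_le.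
Qed.

Lemma gauss_term_bounded p (A B s : R) : cabs p < 1 -> s < 1 ->
  exists M : R, forall a b n, cabs a <= A -> cabs b <= B -> cabs (a * b * p) <= s ->
    cabs (gauss_term p a b n) <= M * cabs p ^+ n.
Proof.
move=> p1 s1; have [M HM] := hyp_ratio_bounded A B p1 s1.
exists M => a b n aA bB cs; rewrite mulrC /gauss_term cabsM cabsX.
apply: ler_pM; rewrite ?exprn_ge0 ?cabs_ge0 //; last exact: HM.
by rewrite ler_wiXn2l ?cabs_ge0 ?leq_bin2 // ltW.
Qed.

Lemma cvg_gauss_series p a b : cabs p < 1 -> cabs (a * b * p) < 1 ->
  series (gauss_term p a b) @ \oo --> limn (series (gauss_term p a b)).
Proof.
move=> p1 abp1; have [M HM] := gauss_term_bounded (cabs a) (cabs b) p1 abp1.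
have p01 : 0 <= cabs p < 1 by rewrite cabs_ge0.
by apply: (cvg_series_dominated p01) => n; apply: HM.
Qed.

(** The n-th term of the difference on the left is g_(n+1) - g_n, where
    g_(N+1) is the right-hand side and g_0 = 0. This can be checked one term
    at a time, once all the factorials are expressed through (ap)_N,
    (b)_(N+1), (p)_N and (abp; p^2)_(N+1). *)
Lemma gauss_telescope p a b N : cabs p < 1 -> cabs (a * b * p) < 1 ->
  series (gauss_term p a b) N.+1 -
    (1 - a * p) / (1 - a * b * p) * series (gauss_term p (a * p ^+ 2) b) N.+1 =
  a * p ^+ 'C(N.+2, 2) * qpoch b p N.+1 * qpoch (a * p) p N /
    (qpoch p p N * qpoch (a * b * p) (p ^+ 2) N.+1).
Proof.
move=> p1 abp1; have pp1 := cabs_sqr_lt1 p1.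
have abp0 : 1 - a * b * p != 0 by apply: sub1_neq0.
rewrite /series /=; elim: N => [|N IH].
  rewrite !big_nat1 /gauss_term /hyp_ratio /= !qpoch0 !qpochS !qpoch0 !expr0 /=.
  by field; rewrite abp0.
rewrite [in X in X - _]big_nat_recr // [in X in _ - _ * X]big_nat_recr //=.
rewrite mulrDr opprD addrACA IH /gauss_term /hyp_ratio.
have -> : a * p ^+ 2 * b * p = a * b * p * p ^+ 2 by ring.
have D0 := qpoch_neq0 N.+1 abp1 pp1.
have Q0 := qpoch_neq0 N p1 p1.
have P1 : 1 - p * p ^+ N != 0 by apply: sub1_neq0; apply: cabs_factor_lt1.
have D1 : 1 - a * b * p * (p ^+ 2) ^+ N.+1 != 0.
  by apply: sub1_neq0; apply: cabs_factor_lt1.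
have EA : (1 - a * p) * qpoch (a * p ^+ 2) p N.+1 =
    qpoch (a * p) p N * (1 - a * p * p ^+ N) * (1 - a * p * p ^+ N.+1).
  by rewrite -!qpochS (qpoch_recl (a * p)); congr (_ * qpoch _ _ _); ring.
have ED : (1 - a * b * p) * qpoch (a * b * p * p ^+ 2) (p ^+ 2) N.+1 =
    qpoch (a * b * p) (p ^+ 2) N.+1 * (1 - a * b * p * (p ^+ 2) ^+ N.+1).
  by rewrite -qpochS (qpoch_recl (a * b * p)).
have -> : (1 - a * p) / (1 - a * b * p) *
   (p ^+ 'C(N.+2, 2) * (qpoch (a * p ^+ 2) p N.+1 * qpoch b p N.+1 /
     (qpoch p p N.+1 * qpoch (a * b * p * p ^+ 2) (p ^+ 2) N.+1))) =
   p ^+ 'C(N.+2, 2) * (((1 - a * p) * qpoch (a * p ^+ 2) p N.+1) * qpoch b p N.+1 /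
     (qpoch p p N.+1 * ((1 - a * b * p) * qpoch (a * b * p * p ^+ 2) (p ^+ 2) N.+1))).
  rewrite !invfM; ring.
rewrite EA ED (qpochS b p N.+1) (qpoch_recl a p N) (qpochS (a * p) p N) (qpochS p p N)
  (qpochS (a * b * p) (p ^+ 2) N.+1).
have EC : p ^+ 'C(N.+3, 2) = p ^+ 'C(N.+2, 2) * (p ^+ 2 * p ^+ N).
  by rewrite (binS N.+2) bin1 exprD !exprS; ring.
have E2 : (p ^+ 2) ^+ N.+1 = (p * p ^+ N) ^+ 2 by rewrite -exprM mulnC exprM (exprS p N).
move: D1 D0 Q0 P1; rewrite EC E2 (exprS p N).
move: (qpoch (a * b * p) _ _) (qpoch p p N) (qpoch b p _) (qpoch (a * p) p N) => D Q B A.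
move: (p ^+ 'C(_, _)) (p ^+ N) => E x D1 D0 Q0 P1.
field.
by rewrite D1 D0 Q0 P1.
Qed.

Definition gauss_series p a b : CC R := limn (series (gauss_term p a b)).

Lemma gauss_termC p a b n : gauss_term p a b n = gauss_term p b a n.
Proof.
by rewrite /gauss_term /hyp_ratio (mulrC b a) (mulrC (qpoch b p n)).
Qed.

(** The right-hand side of [gauss_telescope] tends to 0, as it is a bounded
    quantity times p^((N+1)(N+2)/2). *)
Lemma gauss_series_shift p a b : cabs p < 1 -> cabs (a * b * p) < 1 ->
  gauss_series p a b =
  (1 - a * p) / (1 - a * b * p) * gauss_series p (a * p ^+ 2) b.
Proof.
move=> p1 abp1; have pp1 := cabs_sqr_lt1 p1.
have p01 : 0 <= cabs p < 1 by rewrite cabs_ge0.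
have app1 : cabs (a * p ^+ 2 * b * p) < 1.
  have -> : a * p ^+ 2 * b * p = a * b * p * p ^+ 2 by ring.
  exact: cabsM_lt1.
set c := (1 - a * p) / _; apply/eqP; rewrite -subr_eq0; apply/eqP.
have lim : (fun n => series (gauss_term p a b) n.+1 -
    c * series (gauss_term p (a * p ^+ 2) b) n.+1) @ \oo -->
    gauss_series p a b -
    c * gauss_series p (a * p ^+ 2) b.
  apply: cvgB; last apply: cvgM; first last.
  - by rewrite cvg_shiftS; apply: cvg_gauss_series.
  - exact: cvg_cst.
  - by rewrite cvg_shiftS; apply: cvg_gauss_series.
rewrite -(limE lim); apply: limE.
have [M HM] := hyp_ratio_bounded (cabs (b * p)) (cabs (a * p)) p1 (cabsM_lt1 abp1 pp1).
(* The constant that remains when the factors of index 0 of (b)_(N+1) and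
   (abp; p^2)_(N+1) are split off the telescoped quantity. *)
set k := a * (1 - b) / (1 - a * b * p).
apply: (@cvg_cabs_squeeze _ _ _ (fun N => cabs k * M * cabs p ^+ N)) => [N|]; last first.
  rewrite -(mulr0 (cabs k * M)); apply: cvgM; first exact: cvg_cst.
  by apply: cvg_expr; rewrite ger0_norm // cabs_ge0.
rewrite subr0 gauss_telescope //.
have -> : a * p ^+ 'C(N.+2, 2) * qpoch b p N.+1 * qpoch (a * p) p N /
     (qpoch p p N * qpoch (a * b * p) (p ^+ 2) N.+1) =
   k * hyp_ratio p (b * p) (a * p) (a * b * p * p ^+ 2) N * p ^+ 'C(N.+2, 2).
  by rewrite /hyp_ratio (qpoch_recl b) (qpoch_recl (a * b * p)) /k !invfM; ring.
rewrite 2!cabsM cabsX; apply: ler_pM; rewrite ?mulr_ge0 ?exprn_ge0 ?cabs_ge0 //.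
  by rewrite ler_wpM2l ?cabs_ge0 // HM.
rewrite ler_wiXn2l ?cabs_ge0 //; first exact: ltW.
by rewrite (leq_trans (leqnSn N)) // leq_bin2.
Qed.

Lemma gauss_series_iter p a b N : cabs p < 1 -> cabs (a * b * p) < 1 ->
  gauss_series p a b =
  qpoch (a * p) (p ^+ 2) N / qpoch (a * b * p) (p ^+ 2) N *
    gauss_series p (a * (p ^+ 2) ^+ N) b.
Proof.
move=> p1 abp1; have pp1 := cabs_sqr_lt1 p1.
elim: N => [|N IH]; first by rewrite !qpoch0 expr0 mulr1 divr1 mul1r.
have E : a * (p ^+ 2) ^+ N * b * p = a * b * p * (p ^+ 2) ^+ N by ring.
have abpN1 : cabs (a * (p ^+ 2) ^+ N * b * p) < 1.
  by rewrite E; apply: cabs_factor_lt1.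
rewrite IH (gauss_series_shift p1 abpN1) E !qpochS (exprSr (p ^+ 2) N) (mulrA a).
by rewrite !invfM; ring.
Qed.

(** Iterating [gauss_series_shift] replaces a by ap^(2N), which tends to 0;
    Tannery's theorem gives the limit of the remaining series. *)
Lemma gauss_series_prod p a b : cabs p < 1 -> cabs (a * b * p) < 1 ->
  gauss_series p a b =
  qpoch_inf (a * p) (p ^+ 2) / qpoch_inf (a * b * p) (p ^+ 2) *
    gauss_series p 0 b.
Proof.
move=> p1 abp1; have pp1 := cabs_sqr_lt1 p1.
have p01 : 0 <= cabs p < 1 by rewrite cabs_ge0.
pose x N := (p ^+ 2) ^+ N : CC R.
have x0 : x @ \oo --> (0 : CC R) by apply: cvg_exprC.
have x1 N : cabs (x N) <= 1 by rewrite /x cabsX exprn_ile1 ?cabs_ge0 // ltW.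
have [M HM] := gauss_term_bounded (cabs a) (cabs b) p1 abp1.
have ax0 : (fun N => a * x N) @ \oo --> (0 : CC R).
  by rewrite -(mulr0 a); exact: (cvgM (cvg_cst _) x0).
have cx : (fun N => a * x N * b * p) @ \oo --> (0 * b * p : CC R).
  exact: (cvgM (cvgM ax0 (cvg_cst _)) (cvg_cst _)).
have tan : (fun N => gauss_series p (a * x N) b) @ \oo -->
    gauss_series p 0 b.
  apply: (tannery p01 (C := M)) => [N n|n].
    apply: HM => //; first by rewrite cabsM ler_piMr ?cabs_ge0.
    have -> : a * x N * b * p = a * b * p * x N by ring.
    by rewrite cabsM ler_piMr ?cabs_ge0.
  have nz : qpoch p p n * qpoch (0 * b * p) (p ^+ 2) n != 0.
    by rewrite mulf_neq0 ?qpoch_neq0 // !mul0r cabs0.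
  have num : (fun N => qpoch (a * x N) p n * qpoch b p n) @ \oo -->
      qpoch 0 p n * qpoch b p n.
    exact: (cvgM (cvg_qpoch_arg (q := p) (n := n) ax0) (cvg_cst _)).
  have den : (fun N => qpoch p p n * qpoch (a * x N * b * p) (p ^+ 2) n) @ \oo -->
      qpoch p p n * qpoch (0 * b * p) (p ^+ 2) n.
    exact: (cvgM (cvg_cst _) (cvg_qpoch_arg (q := p ^+ 2) (n := n) cx)).
  exact: (cvgM (cvg_cst _) (cvgM num (cvgV nz den))).
have D0 : qpoch_inf (a * b * p) (p ^+ 2) != 0 by apply: qpoch_inf_neq0.
have lim : (fun N => qpoch (a * p) (p ^+ 2) N / qpoch (a * b * p) (p ^+ 2) N *
      gauss_series p (a * x N) b) @ \oo -->
    qpoch_inf (a * p) (p ^+ 2) / qpoch_inf (a * b * p) (p ^+ 2) * gauss_series p 0 b.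
  exact: (cvgM (cvgM (cvg_qpoch pp1) (cvgV D0 (cvg_qpoch pp1))) tan).
rewrite -(limE lim); apply/esym/limE.
rewrite (_ : (fun N => _) = fun=> gauss_series p a b); first exact: cvg_cst.
by apply/funext => N; rewrite (gauss_series_iter N p1 abp1).
Qed.

(** By symmetry [gauss_series_prod] also removes b, which leaves the value
    S0 at (0, 0). At (1, 0) every term but the first vanishes, so 1 = (p;
    p^2)_oo S0. *)
Theorem gauss_sum p a b : cabs p < 1 -> cabs (a * b * p) < 1 ->
  gauss_series p a b =
  qpoch_inf (a * p) (p ^+ 2) * qpoch_inf (b * p) (p ^+ 2) /
  (qpoch_inf p (p ^+ 2) * qpoch_inf (a * b * p) (p ^+ 2)).
Proof.
move=> p1 abp1; have pp1 := cabs_sqr_lt1 p1.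
(* The condition on abp is void when a or b is 0. *)
have z (c : CC R) : cabs (c * 0 * p) < 1 by rewrite mulr0 mul0r cabs0.
have sym c : gauss_series p 0 c = gauss_series p c 0.
  rewrite /gauss_series; congr (limn (series _)).
  by apply/funext => n; apply: gauss_termC.
pose S0 := gauss_series p 0 0.
have at0 c : gauss_series p c 0 = qpoch_inf (c * p) (p ^+ 2) * S0.
  by rewrite (gauss_series_prod p1 (z c)) mulr0 mul0r qpoch_inf0 divr1.
(* At a = 1 the series stops after its first term. *)
have S0E : 1 = qpoch_inf p (p ^+ 2) * S0.
  have := at0 1; rewrite mul1r => <-; rewrite /gauss_series (@limn_series_finite _ _ 1).
    by rewrite big_nat1 /gauss_term /hyp_ratio !qpoch0 bin_small // expr0 !(mulr1, divr1).
  case=> // k _; rewrite /gauss_term /hyp_ratio qpoch_recl subrr.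
  by rewrite !(mul0r, mulr0).
have Q0 : qpoch_inf p (p ^+ 2) != 0 by apply: qpoch_inf_neq0.
have D0 : qpoch_inf (a * b * p) (p ^+ 2) != 0 by apply: qpoch_inf_neq0.
rewrite (gauss_series_prod p1 abp1) sym at0.
have -> : S0 = (qpoch_inf p (p ^+ 2))^-1 by rewrite -[LHS](mulKf Q0) -S0E mulr1.
move: (qpoch_inf (a * p) _) (qpoch_inf (b * p) _) Q0 D0.
move: (qpoch_inf p _) (qpoch_inf (a * b * p) _) => Q D A B Q0 D0.
by rewrite (invfM Q); ring.
Qed.

(** * A contiguous series *)

(** The contributions of index n on the left add up to (1 + p^n) F_n -
    p^(n-1) F_(n-1), where F_n is the contiguous term; the corrections
    telescope. *)
Lemma contig_partial_sum p a b N : cabs p < 1 -> cabs (a * b * p ^+ 2) < 1 ->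
  series (gauss_term p (a * p) b) N.+1 + series (gauss_term p a (b * p)) N.+1 =
  series (contig_term p a b) N.+1 + p ^+ N * contig_term p a b N.
Proof.
move=> p1 abp1; have pp1 := cabs_sqr_lt1 p1; have p01 : 0 <= cabs p < 1 by rewrite cabs_ge0.
have E1 : a * p * b * p = a * b * p ^+ 2 by ring.
have E2 : a * (b * p) * p = a * b * p ^+ 2 by ring.
elim: N => [|N IH].
  rewrite /series /= !big_nat1 /gauss_term /contig_term /hyp_ratio !qpoch0 !bin_small // !expr0.
  by rewrite !(mulr1, divr1, mul1r).
rewrite !(seriesSr _ N.+1) addrACA IH /gauss_term /contig_term /hyp_ratio.
rewrite E1 E2; set c := a * b * p ^+ 2 in abp1 *.
have D0 := qpoch_neq0 N abp1 pp1.
have Q0 := qpoch_neq0 N p1 p1.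
have P1 : 1 - p * p ^+ N != 0 by apply: sub1_neq0; apply: cabs_factor_lt1.
have D1 : 1 - c * (p ^+ 2) ^+ N != 0 by apply: sub1_neq0; apply: cabs_factor_lt1.
rewrite (qpoch_recl a) (qpoch_recl b) !qpochS.
have EC : p ^+ 'C(N.+2, 2) = p ^+ 'C(N, 2) * (p * p ^+ N * p ^+ N).
  by rewrite (binS N.+1) (binS N) !bin1 !exprD exprS; ring.
have EC' : p ^+ 'C(N.+1, 2) = p ^+ 'C(N, 2) * p ^+ N by rewrite (binS N) bin1 exprD.
have E3 : (p ^+ 2) ^+ N = (p ^+ N) ^+ 2 by rewrite -!exprM mulnC.
move: D1 D0 Q0 P1; rewrite EC EC' E3 (exprS p N) /c.
move: (qpoch (a * b * p ^+ 2) _ _) (qpoch p p N) (qpoch (b * p) p N) (qpoch (a * p) p N) => D Q B A.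
move: (p ^+ 'C(_, _)) (p ^+ N) (series _ N.+1) => E x S D1 D0 Q0 P1.
field; by rewrite D1 D0 Q0 P1.
Qed.

Theorem contig_sum p a b : cabs p < 1 -> cabs (a * b * p ^+ 2) < 1 ->
  series (contig_term p a b) @ \oo -->
  (qpoch_inf (a * p ^+ 2) (p ^+ 2) * qpoch_inf (b * p) (p ^+ 2) +
   qpoch_inf (a * p) (p ^+ 2) * qpoch_inf (b * p ^+ 2) (p ^+ 2)) /
  (qpoch_inf p (p ^+ 2) * qpoch_inf (a * b * p ^+ 2) (p ^+ 2)).
Proof.
move=> p1 abp1; have pp1 := cabs_sqr_lt1 p1.
have p01 : 0 <= cabs p < 1 by rewrite cabs_ge0.
have E1 : a * p * b * p = a * b * p ^+ 2 by ring.
have E2 : a * (b * p) * p = a * b * p ^+ 2 by ring.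
have c1 : cabs (a * p * b * p) < 1 by rewrite E1.
have c2 : cabs (a * (b * p) * p) < 1 by rewrite E2.
have s1 := cvg_gauss_series p1 c1; have s2 := cvg_gauss_series p1 c2.
rewrite -/(gauss_series _ _ _) (gauss_sum p1 c1) E1 in s1.
rewrite -/(gauss_series _ _ _) (gauss_sum p1 c2) E2 in s2.
have rem : (fun N => p ^+ N * contig_term p a b N) @ \oo --> (0 : CC R).
  have [M HM] := hyp_ratio_bounded (cabs (a * p)) (cabs (b * p)) p1 abp1.
  apply: (@cvg_cabs_squeeze _ _ _ (fun N => cabs p ^+ N * M)) => [N|].
    rewrite subr0 cabsM cabsX; apply: ler_pM; rewrite ?exprn_ge0 ?cabs_ge0 //.
    rewrite /contig_term cabsM cabsX -[M]mul1r.
    apply: ler_pM; rewrite ?exprn_ge0 ?cabs_ge0 //; last exact: HM.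
    by rewrite exprn_ile1 ?cabs_ge0 // ltW.
  rewrite -(mul0r M); apply: cvgM; last exact: cvg_cst.
  by apply: cvg_expr; rewrite ger0_norm // cabs_ge0.
have EN : (fun N => series (gauss_term p (a * p) b) N.+1 +
      series (gauss_term p a (b * p)) N.+1 - p ^+ N * contig_term p a b N) =
    (fun N => series (contig_term p a b) N.+1).
  by apply/funext => N; rewrite contig_partial_sum // addrK.
have E3 x : x * p * p = x * p ^+ 2 by rewrite -mulrA.
rewrite E3 in s1; rewrite E3 in s2.
have s1' := s1; rewrite -cvg_shiftS in s1'.
have s2' := s2; rewrite -cvg_shiftS in s2'.
have := cvgB (cvgD s1' s2') rem; rewrite subr0 -mulrDl => lim.
by rewrite -cvg_shiftS -EN; exact: lim.
Qed.

End BasicSeries.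

(** * The octic identity *)

Section MainTheorem.
Variable R : realType.
Implicit Types (a b q : CC R).

Lemma quad_bin2 n : (2 * n * (n - 1) = 4 * 'C(n, 2))%N.
Proof.
elim: n => // n IH; rewrite binS bin1 mulnDr -IH subn1 /=.
by case: n {IH} => // n; rewrite subn1 /=; nia.
Qed.

Definition octic_term q n : CC R :=
  q ^+ (2 * n * (n - 1)) * qpoch (- q ^+ 4) (q ^+ 4) n * qpoch q (q ^+ 2) (2 * n)
  / qpoch (q ^+ 4) (q ^+ 4) (2 * n).

(** Dissect both factorials of length 2n into their even and odd parts: the
    factor (-q^4; q^4)_n then cancels against one half of (q^8; q^8)_n. *)
Lemma octic_termE q n : cabs q < 1 ->
  octic_term q n = (q ^+ 4) ^+ 'C(n, 2) * hyp_ratio (q ^+ 4) q (q ^+ 3) (q ^+ 4) n.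
Proof.
move=> q1; rewrite /octic_term /hyp_ratio.
have q41 : cabs (q ^+ 4) < 1 by rewrite cabsX exprn_ilt1 ?cabs_ge0.
have nz : qpoch (- q ^+ 4) (q ^+ 4) n != 0 by apply: qpoch_neq0; rewrite ?cabsN.
have nz1 : qpoch (q ^+ 4) (q ^+ 4) n != 0 by apply: qpoch_neq0.
have nz2 : qpoch (q ^+ 4) ((q ^+ 4) ^+ 2) n != 0.
  by apply: qpoch_neq0; rewrite ?cabs_sqr_lt1.
have -> : q ^+ (2 * n * (n - 1)) = (q ^+ 4) ^+ 'C(n, 2).
  rewrite -exprM; congr (_ ^+ _).
  exact: quad_bin2.
have -> : qpoch q (q ^+ 2) (2 * n) = qpoch q (q ^+ 4) n * qpoch (q ^+ 3) (q ^+ 4) n.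
  by rewrite qpoch_dissect -exprM -exprS.
have -> : qpoch (q ^+ 4) (q ^+ 4) (2 * n) =
    qpoch (q ^+ 4) ((q ^+ 4) ^+ 2) n * (qpoch (q ^+ 4) (q ^+ 4) n * qpoch (- q ^+ 4) (q ^+ 4) n).
  by rewrite -qpoch_sqr qpoch_dissect.
move: nz nz1 nz2; move: (qpoch (- q ^+ 4) _ _) (qpoch (q ^+ 4) (q ^+ 4) n).
move: (qpoch (q ^+ 4) _ n) (qpoch q _ n) (qpoch (q ^+ 3) _ n) (_ ^+ 'C(n, 2)).
move=> C A B E D P D0 P0 C0; field; by rewrite D0 P0 C0.
Qed.

Lemma qpochs_inf2 a b q : qpochs_inf [:: a; b] q = qpoch_inf a q * qpoch_inf b q.
Proof. by rewrite /qpochs_inf big_cons big_seq1. Qed.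

Lemma ramanujan_f_prod q i j : cabs q < 1 -> (0 < i)%N -> (0 < j)%N ->
  ramanujan_f (- q ^+ i) (- q ^+ j) =
  qpochs_inf [:: q ^+ i; q ^+ j] (q ^+ (i + j)) * qpoch_inf (q ^+ (i + j)) (q ^+ (i + j)).
Proof.
move=> q1 i0 j0.
have small k : (0 < k)%N -> cabs (- q ^+ k) < 1.
  by move=> k0; rewrite cabsN cabsX exprn_ilt1 ?cabs_ge0 // -lt0n.
rewrite (jacobi_triple_product (small i i0) (small j j0)) !opprK mulrNN -exprD.
by rewrite qpochs_inf2.
Qed.

(** For q not 0, [contig_sum] to base q^4 with a = q^-3 and b = q^-1. *)
Lemma octic_sum q : cabs q < 1 ->
  series (octic_term q) @ \oo -->
  (qpochs_inf [:: q; q ^+ 7] (q ^+ 8) + qpochs_inf [:: q ^+ 3; q ^+ 5] (q ^+ 8))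
    / qpoch_inf (q ^+ 4) (q ^+ 8) ^+ 2.
Proof.
move=> q1; rewrite !qpochs_inf2.
have [q0|q0] := eqVneq q 0.
  have z k : (0 : CC R) ^+ k.+1 = 0 by rewrite expr0n.
  rewrite q0 !z !qpoch_inf0 mulr1 expr1n divr1 -(cvg_shiftn 2).
  rewrite (_ : (fun n => _) = fun=> 1 + 1); first exact: cvg_cst.
  apply/funext => n; rewrite /series /=.
  have term k : octic_term 0 k = 0 ^+ (2 * k * (k - 1)).
    have qz c m : qpoch (0 : CC R) c m = 1.
      by rewrite /qpoch big1 // => j _; rewrite mul0r subr0.
    by rewrite /octic_term (z 3) (z 1) oppr0 !qz !mulr1 divr1.
  have t0 : octic_term 0 0 = 1 by rewrite term expr0.
  have t1 : octic_term 0 1 = 1 by rewrite term subnn muln0 expr0.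
  rewrite (@big_cat_nat _ _ _ 2) ?leq_addl //= big_nat_recr //= big_nat1 t0 t1.
  rewrite [in X in _ + X = _]big_nat_cond [X in _ + X = _]big1 ?addr0 //.
  move=> k /andP[/andP[k2 _] _]; rewrite term; case: k k2 => [|[|k]] // _.
  by rewrite (_ : 2 * k.+2 * (k.+2 - 1) = (4 * k + 2 * k * k.+1 + 3).+1)%N ?z //; lia.
have p1 : cabs (q ^+ 4) < 1 by rewrite cabsX exprn_ilt1 ?cabs_ge0.
(* Chosen so that ap = q and bp = q^3 with p = q^4. *)
pose a := q ^- 3; pose b := q^-1.
have aE : a * q ^+ 4 = q by rewrite /a; field.
have bE : b * q ^+ 4 = q ^+ 3 by rewrite /b; field.
have aE2 : a * (q ^+ 4) ^+ 2 = q ^+ 5 by rewrite expr2 mulrA aE -exprS.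
have bE2 : b * (q ^+ 4) ^+ 2 = q ^+ 7 by rewrite expr2 mulrA bE -exprD.
have abE : a * b * (q ^+ 4) ^+ 2 = q ^+ 4.
  by rewrite -mulrA bE2 /a; field.
have c1 : cabs (a * b * (q ^+ 4) ^+ 2) < 1 by rewrite abE.
have := contig_sum p1 c1; rewrite aE bE aE2 bE2 abE -exprM.
have -> : contig_term (q ^+ 4) a b = octic_term q.
  by apply/funext => n; rewrite (octic_termE n q1) /contig_term aE bE abE.
move: (qpoch_inf (q ^+ 5) _) (qpoch_inf (q ^+ 3) _) (qpoch_inf q _) (qpoch_inf (q ^+ 7) _).
move=> x5 x3 x1 x7 lim; rewrite addrC (mulrC x3); exact: lim.
Qed.

End MainTheorem.

Unset Implicit Arguments.

Theorem mainTheorem4 (R : realType) (q : R[i]) (hq : `|q| < 1) :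
  (series (fun n : nat =>
     q ^+ (2 * n * (n - 1)) * qpoch (- q ^+ 4) (q ^+ 4) n
       * qpoch q (q ^+ 2) (2 * n)
     / qpoch (q ^+ 4) (q ^+ 4) (2 * n)) : nat -> R[i]^o) @ \oo -->
    ((ramanujan_f (- q) (- q ^+ 7) + ramanujan_f (- q ^+ 3) (- q ^+ 5))
     / ramanujan_phi (- q ^+ 4) : R[i]^o)
  /\
  (ramanujan_f (- q) (- q ^+ 7) + ramanujan_f (- q ^+ 3) (- q ^+ 5))
    / ramanujan_phi (- q ^+ 4)
  = (qpochs_inf [:: q; q ^+ 7] (q ^+ 8) + qpochs_inf [:: q ^+ 3; q ^+ 5] (q ^+ 8))
    / qpoch_inf (q ^+ 4) (q ^+ 8) ^+ 2.
Proof.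
(* Restated over [CC R], to which the lemmas above apply. *)
suff H (z : CC R) : cabs z < 1 ->
    series (octic_term z) @ \oo -->
      (ramanujan_f (- z) (- z ^+ 7) + ramanujan_f (- z ^+ 3) (- z ^+ 5))
      / ramanujan_phi (- z ^+ 4) /\
    (ramanujan_f (- z) (- z ^+ 7) + ramanujan_f (- z ^+ 3) (- z ^+ 5))
      / ramanujan_phi (- z ^+ 4) =
    (qpochs_inf [:: z; z ^+ 7] (z ^+ 8) + qpochs_inf [:: z ^+ 3; z ^+ 5] (z ^+ 8))
      / qpoch_inf (z ^+ 4) (z ^+ 8) ^+ 2.
  by have := hq; rewrite (@cabs_lt1 R q) => /H.
move=> z1; have z81 : cabs (z ^+ 8) < 1 by rewrite cabsX exprn_ilt1 ?cabs_ge0.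
have E : (ramanujan_f (- z) (- z ^+ 7) + ramanujan_f (- z ^+ 3) (- z ^+ 5))
      / ramanujan_phi (- z ^+ 4) =
    (qpochs_inf [:: z; z ^+ 7] (z ^+ 8) + qpochs_inf [:: z ^+ 3; z ^+ 5] (z ^+ 8))
      / qpoch_inf (z ^+ 4) (z ^+ 8) ^+ 2.
  have f1 := @ramanujan_f_prod R z 1 7 z1 isT isT; rewrite expr1 in f1.
  have f3 := @ramanujan_f_prod R z 3 5 z1 isT isT.
  have f4 := @ramanujan_f_prod R z 4 4 z1 isT isT.
  rewrite /ramanujan_phi f1 f3 f4 -mulrDl.
  have Q0 : qpoch_inf (z ^+ 8) (z ^+ 8) != 0 by apply: qpoch_inf_neq0.
  rewrite (qpochs_inf2 (z ^+ 4)) -expr2.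
  move: (qpoch_inf (z ^+ 8) _) (qpochs_inf _ _ + _) (_ ^+ 2) Q0 => Q F X Q0.
  by rewrite (invfM X) mulrACA (divff Q0) mulr1.
by rewrite E; split=> //; apply: octic_sum.
Qed.
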